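(* Let $\Phi(0,\dots,0)=0$, let $T^+>0$, $r^+>0$, and let $f(r,t)$ be a real function defined for $r\in I=[0,\rho)$, $0<\rho\le\infty$, $r^+\in I$, and $t\in[0,T^+]$, with partial derivative $f'_r=\partial f/\partial r$. Suppose that the following conditions hold. (A$'$) $\|F(u,t)-Au(t)\|_{E_2}\le f(r,t)$ for all $t\in[0,T^+]$, $r\in I$ and $u\in C^{E_1}_{[0,T^+]}$ with values in $S(0,r)$. (E$'$) $\|F'_u(u,t)-A\|\le f'_r(r,t)$ for all $t\in[0,T^+]$, $r\in I$ and $u\in C^{E_1}_{[0,T^+]}$ with values in $S(0,r)$. (G) The functions $f(r,t)$ and $f'_r(r,t)$ are positive for $r>0$, $t>0$ and monotone increasing, $f(0,0)=0$, $f'_r(0,0)\in[0,1)$, and $f(r,t)$ is convex with respect to $r$. Suppose also that the pair $(r,t)=(r^+,T^+)$ satisfies the algebraic system $$r=\|A^{-1}\|\,f(r,t),\qquad 1=\|A^{-1}\|\,f'_r(r,t).$$ Then on $[0,T^+]$ the equation $F(u,t)=0$ has a continuous solution $u^+$ in the space $C^{E_1}_{[0,T^+]}$. Moreover, the approximations $u_n=\mathcal{L}(u_{n-1})$, $u_0=0$, converge to $u^+$ uniformly with respect to $t\in[0,T^+]$, and $$\max_{0\le t\le T^+}\|u^+(t)\|_{E_1}\le r^+.$$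
   Context: $E_1,E_2$ are Banach spaces, $n\ge1$. $C^{E_1}_{[0,T^+]}$ is the Banach space of continuous functions $[0,T^+]\to E_1$ with norm $\|u\|=\max_{0\le t\le T^+}\|u(t)\|_{E_1}$. $S(0,r)\subset E_1$ is the ball of radius $r$ centred at $0$, i.e. $\|x\|_{E_1}\le r$. $\Phi(\omega_1,\dots,\omega_n,u,t):E_1\times\dots\times E_1\times\mathbb{R}\to E_2$ (with $n+1$ factors $E_1$) is a continuous nonlinear operator. For $i=1,\dots,n$, $K_i:\mathbb{R}^{i+1}\times E_1^{\,i}\to E_1$ is a continuous nonlinear operator. For a continuous $u$ with values in $E_1$, $$F(u,t)=\Phi\Big(\int_0^tK_1(t,s,u(s))\,ds,\ \int_0^t\!\!\int_0^tK_2(t,s_1,s_2,u(s_1),u(s_2))\,ds_1ds_2,\dots,\int_0^t\!\!\cdots\!\int_0^tK_n(t,s_1,\dots,s_n,u(s_1),\dots,u(s_n))\,ds_1\cdots ds_n,\ u(t),\ t\Big).$$ The equation $F(u,t)=0$ is to be satisfied for all $t\in[0,T^+]$. $A:E_1\to E_2$ is a continuously invertible bounded linear operator and $\mathcal{L}(u)(t)=A^{-1}\big(Au(t)-F(u,t)\big)$, so that $F(u,t)=0$ is equivalent to $u=\mathcal{L}(u)$. The iteration starts from the zero function $u_0=0$. The operator $F$ is assumed Fréchet differentiable with respect to $u$: for each $t$, $F(u,t)$ depends only on the restriction of $u$ to $[0,t]$, and $u\mapsto F(u,t)$ is Fréchet differentiable as a map from $C([0,t];E_1)$ (max norm) to $E_2$,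 with derivative $F'_u(u,t)$. The norm $\|F'_u(u,t)-A\|$ is the operator norm of the linear map $V\mapsto F'_u(u,t)V-AV(t)$ from $C([0,t];E_1)$ to $E_2$. *)

(* Defs.v *)
From mathcomp Require Import ssreflect ssrfun ssrbool eqtype ssrnat fintype.
From Stdlib Require Import Reals Lra FunctionalExtensionality ProofIrrelevance.
From Coquelicot Require Import Coquelicot.

Set Implicit Arguments.
Unset Strict Implicit.
Unset Printing Implicit Defensive.

Local Open Scope R_scope.

(** * The space C([0,T]; E) with the maximum norm

    Banach spaces are Coquelicot's complete normed modules over [R].  A
    continuous function on [0,T] is represented by its extension to [R] that is
    constant on (-oo,0] and on [T,+oo), so that Leibniz equality on [Cfun E T]
    is equality on [0,T].  Only the case 0 <= T is meaningful. *)

Definition clamp (T s : R) : R := Rmax 0 (Rmin s T).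

Record Cfun (E : NormedModule R_AbsRing) (T : R) := mkCfun {
  cfun :> R -> E;
  cfun_cont : forall s, continuous cfun s;
  cfun_clamp : forall s, cfun (clamp T s) = cfun s }.

Lemma clamp_id T s : 0 <= s <= T -> clamp T s = s.
Proof. move=> H; rewrite /clamp Rmin_left ?Rmax_right; lra. Qed.

Lemma clamp_in T s : 0 <= T -> 0 <= clamp T s <= T.
Proof.
move=> H; rewrite /clamp; split; first exact: Rmax_l.
apply: Rmax_lub => //; exact: Rmin_r.
Qed.

Lemma clamp_neg T s : T <= 0 -> clamp T s = 0.
Proof. move=> H; rewrite /clamp Rmax_left //; apply: Rle_trans H; exact: Rmin_r. Qed.

Lemma clamp_idem T s : clamp T (clamp T s) = clamp T s.
Proof.
case: (Rle_lt_dec 0 T) => H; first by rewrite clamp_id //; exact: clamp_in.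
by rewrite !clamp_neg //; lra.
Qed.

Lemma clamp_lip T x y : Rabs (clamp T y - clamp T x) <= Rabs (y - x).
Proof.
rewrite /clamp /Rmax /Rmin.
case: (Rle_dec y T) => ?; case: (Rle_dec x T) => ?;
  repeat destruct (Rle_dec 0 _); split_Rabs; lra.
Qed.

Lemma continuous_clamp T s : continuous (clamp T) s.
Proof.
move=> P [e He]; exists e => y Hy; apply: He.
exact: Rle_lt_trans (clamp_lip T s y) Hy.
Qed.

Section CfunSpace.
Context {E : NormedModule R_AbsRing} {T : R}.
Implicit Types u v w : Cfun E T.

Lemma Cfun_eq u v : (forall s, u s = v s) -> u = v.
Proof.
case: u v => [u uc ue] [v vc ve] /= H.
have {}H : u = v by apply: functional_extensionality.
case: _ / H vc ve => vc ve; congr mkCfun; exact: proof_irrelevance.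
Qed.

Definition Cplus u v : Cfun E T.
Proof.
refine (@mkCfun E T (fun s => plus (u s) (v s)) _ _).
- abstract (by move=> s; apply: continuous_plus; apply: cfun_cont).
- abstract (by move=> s; rewrite !cfun_clamp).
Defined.

Definition Copp u : Cfun E T.
Proof.
refine (@mkCfun E T (fun s => opp (u s)) _ _).
- abstract (by move=> s; apply: continuous_opp; apply: cfun_cont).
- abstract (by move=> s; rewrite !cfun_clamp).
Defined.

Definition Czero : Cfun E T.
Proof.
refine (@mkCfun E T (fun _ => zero) _ _).
- abstract (by move=> s; apply: continuous_const).
- abstract done.
Defined.

Definition Cscal (a : R) u : Cfun E T.
Proof.
refine (@mkCfun E T (fun s => scal a (u s)) _ _).
- abstract (by move=> s; apply: continuous_scal_r; apply: cfun_cont).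
- abstract (by move=> s; rewrite !cfun_clamp).
Defined.

(** By [cfun_clamp], for 0 <= T the values on [R] are the values on [0,T], so
    this supremum is max_{0 <= s <= T} ||u s||; see [Cnorm_max]. *)
Definition Cnorm u : R := real (Lub_Rbar (fun y => exists s, y = norm (u s))).

Lemma Cfun_maj u : exists s0, clamp T s0 = s0 /\ forall s, norm (u s) <= norm (u s0).
Proof.
have Hc : forall s, continuity_pt (fun s => norm (u s)) s.
  move=> s; apply/continuity_pt_filterlim.
  apply: (filterlim_comp _ _ _ _ norm _ (locally (u s))); first exact: cfun_cont.
  exact: filterlim_norm.
case: (continuity_ab_maj (fun s => norm (u s)) 0 (Rmax 0 T)); first exact: Rmax_l.
  by move=> s _; apply: Hc.
move=> s0 [Hm H0].
have HS : forall s, 0 <= clamp T s <= Rmax 0 T.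
  move=> s; case: (Rle_lt_dec 0 T) => H.
    by rewrite Rmax_right //; apply: clamp_in.
  by rewrite clamp_neg ?Rmax_left //; lra.
exists (clamp T s0); split; first exact: clamp_idem.
move=> s; rewrite -(cfun_clamp u s) (cfun_clamp u s0); exact: Hm.
Qed.

Lemma Cnorm_attained u :
  exists s0, [/\ clamp T s0 = s0, Cnorm u = norm (u s0)
               & forall s, norm (u s) <= norm (u s0)].
Proof.
case: (Cfun_maj u) => s0 [H0 Hm]; exists s0; split=> //.
rewrite /Cnorm (is_lub_Rbar_unique _ (Finite (norm (u s0)))) //; split.
- by move=> y [s ->]; apply: Hm.
- by move=> b Hb; apply: Hb; exists s0.
Qed.

Lemma Cnorm_ub u s : norm (u s) <= Cnorm u.
Proof. by case: (Cnorm_attained u) => s0 [_ -> H]. Qed.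

Lemma Cnorm_lub u M : (forall s, norm (u s) <= M) -> Cnorm u <= M.
Proof. by case: (Cnorm_attained u) => s0 [_ -> _]. Qed.

Lemma Cnorm_max u : 0 <= T ->
  (exists2 s0, 0 <= s0 <= T & Cnorm u = norm (u s0)) /\
  (forall s, 0 <= s <= T -> norm (u s) <= Cnorm u).
Proof.
move=> HT; split; last by move=> s _; apply: Cnorm_ub.
case: (Cnorm_attained u) => s0 [<- -> _]; exists (clamp T s0) => //.
exact: clamp_in.
Qed.

Definition Cfun_AbelianMonoid_mixin : AbelianMonoid.mixin_of (Cfun E T).
Proof.
apply: (AbelianMonoid.Mixin _ Cplus Czero) => *; apply: Cfun_eq => s /=.
- exact: plus_comm.
- exact: plus_assoc.
- exact: plus_zero_r.
Defined.

Canonical Cfun_AbelianMonoid :=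
  AbelianMonoid.Pack (Cfun E T) Cfun_AbelianMonoid_mixin (Cfun E T).

Definition Cfun_AbelianGroup_mixin : AbelianGroup.mixin_of Cfun_AbelianMonoid.
Proof.
apply: (AbelianGroup.Mixin Cfun_AbelianMonoid Copp) => u; apply: Cfun_eq => s /=.
exact: plus_opp_r.
Defined.

Canonical Cfun_AbelianGroup :=
  AbelianGroup.Pack (Cfun E T)
    (AbelianGroup.Class (Cfun E T) _ Cfun_AbelianGroup_mixin) (Cfun E T).

Definition Cfun_ModuleSpace_mixin :
  ModuleSpace.mixin_of R_Ring Cfun_AbelianGroup.
Proof.
apply: (ModuleSpace.Mixin R_Ring Cfun_AbelianGroup Cscal) => *;
  apply: Cfun_eq => s /=.
- exact: scal_assoc.
- exact: scal_one.
- exact: scal_distr_l.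
- exact: scal_distr_r.
Defined.

Canonical Cfun_ModuleSpace :=
  ModuleSpace.Pack R_Ring (Cfun E T)
    (ModuleSpace.Class R_Ring (Cfun E T) _ Cfun_ModuleSpace_mixin) (Cfun E T).

Lemma Cnorm_triangle u v : Cnorm (plus u v) <= Cnorm u + Cnorm v.
Proof.
apply: Cnorm_lub => s; apply: Rle_trans (norm_triangle _ _) _.
apply: Rplus_le_compat; exact: Cnorm_ub.
Qed.

Lemma Cnorm_scal (a : R) u : Cnorm (scal a u) <= Rabs a * Cnorm u.
Proof.
apply: Cnorm_lub => s; apply: Rle_trans (norm_scal a (u s)) _.
apply: Rmult_le_compat_l; [exact: Rabs_pos | exact: Cnorm_ub].
Qed.

Definition Cball u (e : R) v : Prop := Cnorm (minus v u) < e.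

Definition Cfun_UniformSpace_mixin : UniformSpace.mixin_of (Cfun E T).
Proof.
apply: (UniformSpace.Mixin _ Czero Cball).
- move=> u e; rewrite /Cball; apply: Rle_lt_trans (cond_pos e).
  apply: Cnorm_lub => s /=.
  by rewrite /= plus_opp_r norm_zero; apply: Rle_refl.
- move=> u v e; rewrite /Cball => H; apply: Rle_lt_trans H.
  apply: Cnorm_lub => s /=.
  rewrite -norm_opp opp_plus opp_opp plus_comm; exact: (Cnorm_ub (minus v u)).
- move=> u v w e1 e2; rewrite /Cball => H1 H2.
  apply: (Rle_lt_trans _ (Cnorm (minus w v) + Cnorm (minus v u))); last by lra.
  apply: Rle_trans (Cnorm_triangle _ _).
  by rewrite -minus_trans; apply: Rle_refl.
Defined.

Canonical Cfun_UniformSpace :=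
  UniformSpace.Pack (Cfun E T) Cfun_UniformSpace_mixin (Cfun E T).

Canonical Cfun_NormedModuleAux :=
  NormedModuleAux.Pack R_AbsRing (Cfun E T)
    (NormedModuleAux.Class R_AbsRing (Cfun E T)
      (ModuleSpace.class R_Ring Cfun_ModuleSpace)
      Cfun_UniformSpace_mixin) (Cfun E T).

Definition Cfun_NormedModule_mixin :
  NormedModule.mixin_of R_AbsRing Cfun_NormedModuleAux.
Proof.
apply: (NormedModule.Mixin R_AbsRing Cfun_NormedModuleAux Cnorm 1).
- exact: Cnorm_triangle.
- exact: Cnorm_scal.
- by [].
- by move=> u v e; rewrite Rmult_1_l.
- move=> u H; apply: Cfun_eq => s /=; apply: norm_eq_zero.
  apply: Rle_antisym; last exact: norm_ge_0.
  by rewrite -H; apply: Cnorm_ub.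
Defined.

Canonical Cfun_NormedModule :=
  NormedModule.Pack R_AbsRing (Cfun E T)
    (NormedModule.Class R_AbsRing (Cfun E T) _ Cfun_NormedModule_mixin)
    (Cfun E T).

End CfunSpace.

Definition Crestrict (E : NormedModule R_AbsRing) (T t : R) (u : Cfun E T) :
  Cfun E t.
Proof.
refine (@mkCfun E t (fun s => u (clamp t s)) _ _).
- abstract (move=> s; apply: continuous_comp;
            [exact: continuous_clamp | exact: cfun_cont]).
- abstract (by move=> s; rewrite clamp_idem).
Defined.

(** * Operator norm

    [real] loses nothing for a bounded linear [l]: the supremum is finite. *)

Definition opnorm (U V : NormedModule R_AbsRing) (l : U -> V) : R :=
  real (Lub_Rbar (fun y => exists x : U, norm x <= 1 /\ y = norm (l x))).

(** * The integro-functional operator *)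

Definition snoc (X : Type) (k : nat) (s : 'I_k -> X) (x : X) : 'I_k.+1 -> X :=
  fun i => if unlift ord_max i is Some j then s j else x.

(** The k-fold integral of [g] over [0,t]^k as an iterated integral, the first
    variable being integrated innermost (the order is immaterial for continuous
    [g]).  The constant in the case k = 0 is a function on the empty type
    ['I_0]. *)
Fixpoint cube_RInt (E : CompleteNormedModule R_AbsRing) (t : R) (k : nat) :
    (('I_k -> R) -> E) -> E :=
  match k with
  | 0%nat => fun g => g (fun _ => 0)
  | S k' => fun g =>
      RInt (fun x => cube_RInt t (fun s : 'I_k' -> R => g (snoc s x))) 0 t
  end.

(** [K i] is the kernel with i+1 integration variables, for 0 <= i < n. *)
Definition Fop (E1 E2 : CompleteNormedModule R_AbsRing) (n : nat)
    (Phi : ('I_n -> E1) -> E1 -> R -> E2)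
    (K : forall i : 'I_n, R -> ('I_i.+1 -> R) -> ('I_i.+1 -> E1) -> E1)
    (u : R -> E1) (t : R) : E2 :=
  Phi (fun i => cube_RInt t (fun s => K i t s (fun j => u (s j)))) (u t) t.

Definition Lop (E1 E2 : CompleteNormedModule R_AbsRing) (n : nat)
    (Phi : ('I_n -> E1) -> E1 -> R -> E2)
    (K : forall i : 'I_n, R -> ('I_i.+1 -> R) -> ('I_i.+1 -> E1) -> E1)
    (A : E1 -> E2) (Ainv : E2 -> E1) (u : R -> E1) (t : R) : E1 :=
  Ainv (minus (A (u t)) (Fop Phi K u t)).

(** The interval [0,rho), with rho possibly infinite. *)
Definition inI (rho : Rbar) (r : R) : Prop := 0 <= r /\ Rbar_lt r rho.

Definition in_ball (E : NormedModule R_AbsRing) (T : R) (u : Cfun E T) (r : R) :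
  Prop := forall s, 0 <= s <= T -> norm (u s) <= r.

(* Main.v *)
Require Import Defs.
From mathcomp Require Import ssreflect ssrfun ssrbool eqtype ssrnat seq fintype.
From Stdlib Require Import Reals Lra.
From Coquelicot Require Import Coquelicot.

Local Open Scope R_scope.

(** With b = ||A^-1||, the sequence r_0 = 0, r_(k+1) = b f(r_k, T+) increases and
    is bounded by its fixed point r+.  It majorizes the iteration:
    ||u_(k+1) - u_k|| <= r_(k+1) - r_k in the maximum norm.  Indeed, along the
    segment from u_(k-1) to u_k the derivative of F - A is bounded by f'_r at the
    corresponding point of [r_(k-1), r_k], and a mean value inequality gives
    ||(F - A)(u_k) - (F - A)(u_(k-1))|| <= f(r_k, T+) - f(r_(k-1), T+).
    So (u_k) is a Cauchy sequence; since F(u_k, t) = A(u_k(t) - u_(k+1)(t)), its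
    limit is a solution. *)

(** * Compactness of intervals and preliminary facts on filters and norms *)

(** Real induction: let [c] be the supremum of the [x] for which [P a x] holds. The local hypothesis
    at [c] first reaches [c] from below and then passes beyond it, unless [c = b]. It serves both to
    make estimates uniform over a compact interval and to chain local increments. *)
Lemma interval_local_to_global (P : R -> R -> Prop) (a b : R) : a <= b ->
  (forall x y z, a <= x -> x <= y -> y <= z -> z <= b ->
     P x y -> P y z -> P x z) ->
  (forall x, a <= x <= b -> exists2 d, 0 < d & forall y z,
     a <= y <= x -> x <= z <= b -> x - d < y -> z < x + d -> P y z) ->
  P a b.
Proof.
move=> Hab Htr Hloc.
pose S x := a <= x <= b /\ P a x.
have Sa : S a.
  split; first lra.
  by case: (Hloc a) => [|d Hd H]; [lra | apply: H; lra].
have Sb : bound S by exists b => x [Hx _]; lra.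
case: (completeness S Sb) => [|c [Hub Hlub]]; first by exists a.
have Hc : a <= c <= b by split; [exact: Hub | apply: Hlub => x [Hx _]; lra].
case: (Hloc c Hc) => d Hd HP.
have [x [Sx Hx]] : exists x, S x /\ c - d < x.
  apply: Classical_Prop.NNPP => Hn.
  suff : c <= c - d by lra.
  apply: Hlub => x Sx; apply: Rnot_lt_le => Hx; apply: Hn; by exists x.
have Hxc := Hub x Sx.
case: Sx => Hxab Pax.
(* This point lies beyond [c] unless it equals [b]; since no element of [S] exceeds [c], it must be
   [b]. *)
have Sz : S (Rmin b (c + d / 2)).
  have Hz1 := Rmin_l b (c + d / 2); have Hz2 := Rmin_r b (c + d / 2).
  have Hz3 : c <= Rmin b (c + d / 2) by apply: Rmin_glb; lra.
  split; first lra.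
  by apply: (Htr a x) => //; try lra; apply: HP; lra.
have := Hub _ Sz; case: Sz => _; rewrite /Rmin.
by case: Rle_dec => // ? ? ?; lra.
Qed.

Lemma filter_forall_ord {T : Type} {F : (T -> Prop) -> Prop} {FF : Filter F}
  {k : nat} (P : 'I_k -> T -> Prop) :
  (forall i, F (P i)) -> F (fun x => forall i, P i x).
Proof.
move=> H.
suff : forall s : seq 'I_k, F (fun x => forall i, i \in s -> P i x).
  move=> Hs; apply: filter_imp (Hs (enum 'I_k)) => x Hx i.
  by apply: Hx; rewrite mem_enum.
elim=> [|j s IH]; first exact: filter_forall.
apply: filter_imp (filter_and _ _ (H j) IH) => x [Hj Hs] i.
by rewrite in_cons => /orP [/eqP -> //|]; exact: Hs.
Qed.

Lemma norm_minus_triangle {V : NormedModule R_AbsRing} (x y z : V) :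
  norm (minus x z) <= norm (minus x y) + norm (minus y z).
Proof. by rewrite (minus_trans y); exact: norm_triangle. Qed.

Lemma norm_minus_sym {V : NormedModule R_AbsRing} (x y : V) :
  norm (minus x y) = norm (minus y x).
Proof. by rewrite -norm_opp opp_minus. Qed.

(** * Continuity of maps into products and function spaces *)

Section Continuity.
Context {X : UniformSpace}.

(** Closeness in the function space is uniform over the index. A finite index set allows the
    neighbourhoods of the components to be intersected. *)
Lemma continuous_fct_ord {Y : UniformSpace} {k : nat} (F : X -> 'I_k -> Y) x :
  (forall i, continuous (fun y => F y i) x) -> continuous F x.
Proof.
move=> H; apply/filterlim_locally => e.
by apply: filter_forall_ord => i; move/filterlim_locally: (H i); apply.
Qed.

Lemma continuous_pair {Y Z : UniformSpace} (F : X -> Y) (G : X -> Z) x :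
  continuous F x -> continuous G x -> continuous (fun y => (F y, G y)) x.
Proof.
move=> /filterlim_locally HF /filterlim_locally HG.
by apply/filterlim_locally => e; apply: filter_and; [exact: HF | exact: HG].
Qed.

Lemma continuous_fct_eval {Y : UniformSpace} {T : Type} (F : X -> T -> Y) j x :
  continuous F x -> continuous (fun y => F y j) x.
Proof.
move=> /filterlim_locally HF; apply/filterlim_locally => e.
by apply: filter_imp (HF e) => y; apply.
Qed.

Lemma continuous_snoc {k : nat} (s : X -> 'I_k -> R) (y : X -> R) x :
  continuous s x -> continuous y x -> continuous (fun p => snoc (s p) (y p)) x.
Proof.
move=> Hs Hy; apply: continuous_fct_ord => i; rewrite /snoc.
by case: unlift => // j; exact: continuous_fct_eval.
Qed.

End Continuity.

Lemma continuous_fst' {Y Z : UniformSpace} (p : Y * Z) : continuous fst p.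
Proof. by case: p => y z; exact: continuous_fst. Qed.

Lemma continuous_snd' {Y Z : UniformSpace} (p : Y * Z) : continuous snd p.
Proof. by case: p => y z; exact: continuous_snd. Qed.

Lemma continuous_ex_RInt {E : CompleteNormedModule R_AbsRing} (g : R -> E) a b :
  (forall y, continuous g y) -> ex_RInt g a b.
Proof. by move=> H; apply: ex_RInt_continuous => y _. Qed.

(** * Continuity of integrals depending on a parameter *)

Section Integrals.
Context {X : UniformSpace} {E : CompleteNormedModule R_AbsRing}.

(** Joint continuity at [(x, y0)] gives a product neighbourhood; compactness of [0,1] then yields
    one neighbourhood of [x] on which the integrands are close for all [y] at once, and integration
    preserves the bound. *)
Lemma continuous_RInt_param01 (H : X -> R -> E) x :
  (forall p : X * R, continuous (fun p => H p.1 p.2) p) ->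
  continuous (fun x => RInt (H x) 0 1) x.
Proof.
move=> Hc.
have Hx x' : ex_RInt (H x') 0 1.
  apply: continuous_ex_RInt => y.
  apply: (continuous_comp (fun y => (x', y)) (fun p => H p.1 p.2)) => //.
  by apply: continuous_pair; [exact: continuous_const | exact: continuous_id].
apply/filterlim_locally_ball_norm => e.
(* The bound on the integral is not strict, so aiming at [e / 2] leaves room for the strict
   inequality of [ball_norm]. *)
have He2 : 0 < e / 2 by move: (cond_pos e); lra.
have Hloc : locally x (fun x' => forall y, 0 <= y <= 1 ->
    norm (minus (H x' y) (H x y)) <= e / 2).
  apply: (interval_local_to_global (fun a b => locally x (fun x' =>
    forall y, a <= y <= b -> norm (minus (H x' y) (H x y)) <= e / 2))).
  - exact: Rle_0_1.
  - move=> a b c _ Hab Hbc _ H1 H2.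
    apply: filter_imp (filter_and _ _ H1 H2) => x' [H1' H2'] y Hy.
    by case: (Rle_lt_dec y b) => ?; [apply: H1' | apply: H2']; lra.
  - move=> y0 _.
    have He4 : 0 < e / 4 by lra.
    have /filterlim_locally_ball_norm /(_ (mkposreal _ He4)) [d Hd] := Hc (x, y0).
    exists d; first exact: cond_pos.
    move=> a b [_ Ha] [Hb _] Ha' Hb'; exists d => x' Hx' y Hy.
    have By : ball y0 d y by apply: Rabs_def1; rewrite /minus /plus /opp /=; lra.
    (* Both integrands are compared with the value at the centre [(x, y0)], hence the quarters. *)
    apply: Rle_trans (norm_minus_triangle _ (H x y0) _) _.
    have H1 : norm (minus (H x' y) (H x y0)) < e / 4 by apply: (Hd (x', y)).
    have H2 : norm (minus (H x y) (H x y0)) < e / 4.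
      by apply: (Hd (x, y)); split => //; exact: ball_center.
    rewrite norm_minus_sym in H2.
    apply: (Rle_trans _ (e / 4 + e / 4)); last lra.
    by apply: Rplus_le_compat; apply: Rlt_le.
apply: filter_imp Hloc => x' Hx'.
rewrite /ball_norm; apply: (Rle_lt_trans _ ((1 - 0) * (e / 2))); last first.
  by move: (cond_pos e); lra.
apply: norm_RInt_le_const Hx' _; first lra.
by apply: is_RInt_minus; apply: RInt_correct.
Qed.

Lemma continuous_RInt_param (H : X -> R -> E) (t : X -> R) x :
  (forall p : X * R, continuous (fun p => H p.1 p.2) p) ->
  (forall x, continuous t x) ->
  continuous (fun x => RInt (H x) 0 (t x)) x.
Proof.
move=> Hc Ht.
(* Rescaling to [0,1] makes the bounds independent of the parameter. *)
have HE x' : RInt (fun y => scal (t x') (H x' (t x' * y + 0))) 0 1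
             = RInt (H x') 0 (t x').
  rewrite RInt_comp_lin.
    by congr (RInt _ _ _); ring.
  apply: continuous_ex_RInt => y.
  apply: (continuous_comp (fun y => (x', y)) (fun p => H p.1 p.2)) => //.
  by apply: continuous_pair; [exact: continuous_const | exact: continuous_id].
apply: (continuous_ext _ _ _ HE).
apply: (continuous_RInt_param01
  (fun x' y => scal (t x') (H x' (t x' * y + 0)))) => p.
have Ht1 : continuous (fun p : X * R => t p.1) p.
  by apply: (continuous_comp fst t) => //; exact: continuous_fst'.
apply: continuous_scal => //.
apply: (continuous_comp (fun p : X * R => (p.1, t p.1 * p.2 + 0))
  (fun p => H p.1 p.2)) => //.
apply: continuous_pair; first exact: continuous_fst'.
apply: continuous_plus; last exact: continuous_const.
apply: (continuous_mult (fun p : X * R => t p.1) snd) => //.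
exact: continuous_snd'.
Qed.

End Integrals.

Lemma continuous_cube_RInt {X : UniformSpace}
  {E : CompleteNormedModule R_AbsRing} {k : nat}
  (g : X -> ('I_k -> R) -> E) (t : X -> R) x :
  (forall p : X * ('I_k -> R), continuous (fun p => g p.1 p.2) p) ->
  (forall x, continuous t x) ->
  continuous (fun x => cube_RInt (t x) (g x)) x.
Proof.
elim: k X g t x => [|k IH] X g t x Hg Ht /=.
  apply: (continuous_comp (fun x => (x, fun _ => 0)) (fun p => g p.1 p.2)) => //.
  by apply: continuous_pair; [exact: continuous_id | exact: continuous_const].
apply: (continuous_RInt_param
  (fun x y => cube_RInt (t x) (fun s => g x (snoc s y)))) => // q.
(* The outer integration variable joins the parameter, so the induction hypothesis is used with
   parameter space [X * R]; this is why [X] is generalized. *)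
apply: (IH _ (fun (q : X * R) s => g q.1 (snoc s q.2)) (fun q => t q.1)) => p.
  apply: (continuous_comp (fun p : X * R * ('I_k -> R) =>
    (p.1.1, snoc p.2 p.1.2)) (fun p => g p.1 p.2)) => //.
  have Hp1 := continuous_fst' p.
  apply: continuous_pair.
    by apply: (continuous_comp fst fst) => //; exact: continuous_fst'.
  apply: continuous_snoc; first exact: continuous_snd'.
  by apply: (continuous_comp fst snd) => //; exact: continuous_snd'.
by apply: (continuous_comp fst t) => //; exact: continuous_fst'.
Qed.

Lemma cube_RInt_ext {E : CompleteNormedModule R_AbsRing} {k : nat} t
  (g h : ('I_k -> R) -> E) : 0 <= t ->
  (forall s, (forall i, 0 <= s i <= t) -> g s = h s) ->
  cube_RInt t g = cube_RInt t h.
Proof.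
move=> Ht; elim: k g h => [|k IH] g h Hgh /=.
  by apply: Hgh => -[].
apply: RInt_ext => y; rewrite Rmin_left // Rmax_right // => Hy.
apply: IH => s Hs; apply: Hgh => i; rewrite /snoc.
by case: unlift => // ; lra.
Qed.

(** * The operator F: dependence on the past and continuity in time *)

Section Operator.
Context {E1 E2 : CompleteNormedModule R_AbsRing} {n : nat}.
Context (Phi : ('I_n -> E1) -> E1 -> R -> E2).
Context (K : forall i : 'I_n, R -> ('I_i.+1 -> R) -> ('I_i.+1 -> E1) -> E1).

(** All arguments of [u] in F(u,t) lie in [0,t]. This links functions on [0,T] with the derivative
    of F(.,t), which lives on C([0,t]). *)
Lemma Fop_restrict {T} (u : Cfun E1 T) t : 0 <= t ->
  Fop Phi K (Crestrict t u) t = Fop Phi K u t.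
Proof.
move=> Ht; rewrite /Fop [Crestrict t u t]/= clamp_id; last lra.
congr (Phi _ _ _); apply: FunctionalExtensionality.functional_extensionality => i.
apply: cube_RInt_ext => // s Hs; congr (K i t s _).
apply: FunctionalExtensionality.functional_extensionality => j.
exact: (congr1 u (clamp_id (Hs j))).
Qed.

Context (hPhi : forall p : ('I_n -> E1) * E1 * R,
  continuous (fun p : ('I_n -> E1) * E1 * R => Phi p.1.1 p.1.2 p.2) p).
Context (hK : forall (i : 'I_n) (p : R * ('I_i.+1 -> R) * ('I_i.+1 -> E1)),
  continuous (fun p : R * ('I_i.+1 -> R) * ('I_i.+1 -> E1) =>
    K i p.1.1 p.1.2 p.2) p).

Lemma continuous_Fop (u : R -> E1) t :
  (forall s, continuous u s) -> continuous (Fop Phi K u) t.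
Proof.
move=> Hu.
apply: (continuous_comp (fun t => ((fun i => cube_RInt t (fun s =>
  K i t s (fun j => u (s j)))) , u t, t)) (fun p => Phi p.1.1 p.1.2 p.2)) => //.
apply: continuous_pair; last exact: continuous_id.
apply: continuous_pair => //.
apply: continuous_fct_ord => i.
apply: (continuous_cube_RInt (fun t s => K i t s (fun j => u (s j))) id) => [p|s];
  last exact: continuous_id.
apply: (continuous_comp (fun p : R * ('I_i.+1 -> R) =>
  (p, fun j => u (p.2 j))) (fun p => K i p.1.1 p.1.2 p.2)) => //.
apply: continuous_pair; first exact: continuous_id.
apply: continuous_fct_ord => j.
apply: (continuous_comp (fun p : R * ('I_i.+1 -> R) => p.2 j) u) => //.
by apply: (continuous_fct_eval snd); exact: continuous_snd'.
Qed.

End Operator.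

(** * Operator norm bound and mean value inequality *)

(** The bound contained in [is_linear] makes the supremum finite, so [real] returns the true
    supremum; homogeneity then extends the estimate from the unit ball. *)
Lemma opnorm_ub {U V : NormedModule R_AbsRing} (l : U -> V) x :
  is_linear l -> norm (l x) <= opnorm l * norm x.
Proof.
move=> Hl; have [M [HM Hb]] := linear_norm _ Hl.
have Hub z : norm z <= 1 -> norm (l z) <= opnorm l.
  move=> Hz; rewrite /opnorm.
  have [H1 H2] := Lub_Rbar_correct (fun y => exists x : U, norm x <= 1 /\ y = norm (l x)).
  have := H1 (norm (l z)) (ex_intro _ z (conj Hz erefl)).
  have : Rbar_le (Lub_Rbar (fun y => exists x : U, norm x <= 1 /\ y = norm (l x))) M.
    apply: H2 => y [z' [Hz' ->]] /=; apply: Rle_trans (Hb z') _.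
    by rewrite -{2}(Rmult_1_r M); apply: Rmult_le_compat_l => //; lra.
  by case: Lub_Rbar.
case: (Req_dec (norm x) 0) => Hx.
  by move: (Hb x); rewrite Hx !Rmult_0_r.
have Hx0 : 0 < norm x by have := norm_ge_0 x; lra.
have Hs : x = scal (norm x) (scal (/ norm x) x).
  by rewrite scal_assoc /mult /= Rinv_r // scal_one.
rewrite {1}Hs (linear_scal _ Hl); apply: Rle_trans (norm_scal _ _) _.
rewrite Rmult_comm /abs /= Rabs_pos_eq; last lra.
apply: Rmult_le_compat_r; first lra.
apply: Hub; apply: Rle_trans (norm_scal _ _) _.
by rewrite /abs /= Rabs_pos_eq ?Rinv_l; auto with real.
Qed.

(** Near each point, increments of [g] from that point are dominated by those of [h] up to slope
    [e]. Monotonicity of [h] makes the bounds on the two sides of the point add up,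
    [interval_local_to_global] chains them, and finally [e] tends to 0. *)
Lemma mean_value_majorant {V : NormedModule R_AbsRing} (g : R -> V) (h : R -> R)
  a b : a <= b ->
  (forall x y, a <= x -> x <= y -> y <= b -> h x <= h y) ->
  (forall x e, a <= x <= b -> 0 < e -> exists2 d, 0 < d & forall y,
     a <= y <= b -> Rabs (y - x) < d ->
     norm (minus (g y) (g x)) <= Rabs (h y - h x) + e * Rabs (y - x)) ->
  norm (minus (g b) (g a)) <= h b - h a.
Proof.
move=> Hab Hh Hloc.
have Hmain e : 0 < e -> norm (minus (g b) (g a)) <= h b - h a + e * (b - a).
  move=> He; apply: (interval_local_to_global (fun y z =>
    norm (minus (g z) (g y)) <= h z - h y + e * (z - y)) _ _ Hab).
    move=> x y z _ _ _ _ H1 H2.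
    by apply: Rle_trans (norm_minus_triangle _ (g y) _) _; lra.
  move=> x Hx; case: (Hloc x e Hx He) => d Hd H.
  exists d => // y z Hy Hz Hyd Hzd.
  have Hyx : h y <= h x by apply: Hh; lra.
  have Hxz : h x <= h z by apply: Hh; lra.
  have := H y; rewrite (Rabs_left1 (y - x)); last lra.
  rewrite Rabs_left1; last lra; move=> H1.
  have := H z; rewrite (Rabs_pos_eq (z - x)); last lra.
  rewrite Rabs_pos_eq; last lra; move=> H2.
  apply: Rle_trans (norm_minus_triangle _ (g x) _) _.
  rewrite (norm_minus_sym (g x)).
  apply: (Rle_trans _ ((h z - h x + e * (z - x)) + (- (h y - h x) + e * - (y - x))));
    last lra.
  by apply: Rplus_le_compat; [apply: H2 | apply: H1]; lra.
apply: le_epsilon => e He.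
have Hba : 0 < b - a + 1 by lra.
(* The [+ 1] covers the degenerate interval [a = b]. *)
have He' : 0 < e / (b - a + 1) by exact: Rdiv_lt_0_compat.
apply: Rle_trans (Hmain _ He') _; apply: Rplus_le_compat_l.
have {2}-> : e = e / (b - a + 1) * (b - a + 1) by field; lra.
by apply: Rmult_le_compat_l; lra.
Qed.

Lemma is_linear_minus {U V : NormedModule R_AbsRing} (l m : U -> V) :
  is_linear l -> is_linear m -> is_linear (fun x => minus (l x) (m x)).
Proof.
move=> Hl Hm.
exact: (is_linear_comp (fun x => (l x, opp (m x))) (fun p => plus p.1 p.2)
  (is_linear_prod _ _ Hl (is_linear_comp _ _ Hm is_linear_opp)) is_linear_plus).
Qed.

(** * The space C([0,T]; E): evaluation, restriction, completeness *)

Lemma is_linear_eval {E : NormedModule R_AbsRing} {T} t :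
  is_linear (fun u : Cfun E T => u t).
Proof.
split=> //; exists 1; split=> [|u]; first exact: Rlt_0_1.
rewrite Rmult_1_l; exact: (Cnorm_ub u t).
Qed.

Lemma Cnorm_restrict {E : NormedModule R_AbsRing} {T} t (u : Cfun E T) :
  norm (Crestrict t u) <= norm u.
Proof. by apply: Cnorm_lub => s; exact: (Cnorm_ub u). Qed.

(** The uniform limit exists in the complete space of all functions from [R] to [E]; it remains to
    see that continuity and invariance under [clamp] pass to the limit. *)
Lemma Cfun_cauchy_cvg {E : CompleteNormedModule R_AbsRing} {T}
  (w : nat -> Cfun E T) :
  (forall e : posreal, exists N, forall p q, (N <= p)%coq_nat ->
     (N <= q)%coq_nat -> norm (minus (w p) (w q)) < e) ->
  exists v, filterlim w eventually (locally v).
Proof.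
move=> Hw.
have Hcau (e : posreal) : exists P, eventually P /\
    forall p q, P p -> P q -> forall s, ball (w p s) e (w q s).
  case: (Hw e) => N HN; exists (fun k => (N <= k)%coq_nat); split.
    by exists N.
  move=> p q Hp Hq s; apply: norm_compat1.
  apply: Rle_lt_trans (HN q p Hq Hp); exact: (Cnorm_ub (minus (w q) (w p))).
have [v Hv] := proj1 (filterlim_locally_cauchy (U := fct_CompleteSpace (T := R) (U := E))
  (F := eventually) (fun k => w k : R -> E)) Hcau.
have {}Hv (e : posreal) :
    eventually (fun k => forall s, ball (v s) e (w k s)).
  by move/filterlim_locally: Hv => /(_ e).
have Hvc s : continuous v s.
  apply/filterlim_locally => e.
  have He3 : 0 < e / 3 by move: (cond_pos e); lra.
  have [N /(_ N (le_n N)) HN] := Hv (mkposreal _ He3).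
  have /filterlim_locally /(_ (mkposreal _ He3)) := @cfun_cont E T (w N) s.
  apply: filter_imp => y Hy.
  have -> : pos e = e / 3 + e / 3 + e / 3 by field.
  apply: (ball_triangle _ (w N y)); last exact: ball_sym.
  by apply: (ball_triangle _ (w N s)).
have Hpt s : filterlim (fun k => w k s) eventually (locally (v s)).
  by apply/filterlim_locally => e; apply: filter_imp (Hv e).
have Hve s : v (clamp T s) = v s.
  apply: (filterlim_locally_unique (F := eventually) (fun k => w k s) _ _ _ (Hpt s)).
  by apply: filterlim_ext (Hpt (clamp T s)) => k; rewrite cfun_clamp.
exists (mkCfun Hvc Hve); apply/filterlim_locally => e.
(* Passing from balls of [E] to its norm costs [norm_factor]; the 2 makes the supremum at most
   [e / 2], hence strictly below [e]. *)
have Hf : 0 < 2 * norm_factor (V := E).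
  by apply: Rmult_lt_0_compat; [lra | exact: norm_factor_gt_0].
have He : 0 < e / (2 * norm_factor (V := E)).
  by apply: Rdiv_lt_0_compat => //; exact: cond_pos.
apply: filter_imp (Hv (mkposreal _ He)) => k Hk.
apply: (Rle_lt_trans _ (e / 2)); last by move: (cond_pos e); lra.
apply: Cnorm_lub => s; apply: Rlt_le.
apply: Rlt_le_trans (norm_compat2 _ _ _ (Hk s)) _ => /=.
apply: Req_le; field; move: (norm_factor_gt_0 (V := E)); lra.
Qed.

(** * Increments of the residual F - A along a segment *)

Lemma minus_minus_swap {G : AbelianGroup} (x y z w : G) :
  minus (minus x y) (minus z w) = minus (minus x z) (minus y w).
Proof.
rewrite /minus !opp_plus !opp_opp -!plus_assoc; congr plus.
by rewrite !plus_assoc (plus_comm (opp y)).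
Qed.

Lemma opnorm_ge_0 {U V : NormedModule R_AbsRing} (l : U -> V) :
  is_linear l -> 0 <= opnorm l.
Proof.
move=> Hl; rewrite /opnorm.
have [H1 _] := Lub_Rbar_correct (fun y => exists x : U, norm x <= 1 /\ y = norm (l x)).
have H0 : exists x : U, norm x <= 1 /\ 0 = norm (l x).
  by exists zero; rewrite (linear_zero _ Hl) !norm_zero; split=> //; exact: Rle_0_1.
by have := H1 0 H0; case: Lub_Rbar => [r||] //= _; exact: Rle_refl.
Qed.

(** [h'] stands for the derivative of [h]; only a lower bound on the difference
    quotients within [a, c] is needed. *)
Lemma residual_increment {E1 E2 : CompleteNormedModule R_AbsRing} {n : nat}
  (Phi : ('I_n -> E1) -> E1 -> R -> E2)
  (K : forall i : 'I_n, R -> ('I_i.+1 -> R) -> ('I_i.+1 -> E1) -> E1)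
  (A : E1 -> E2) (T t a c : R) (h h' : R -> R)
  (dF : Cfun E1 t -> Cfun E1 t -> E2) (u v : Cfun E1 T) :
  is_linear A -> 0 <= t <= T -> a <= c ->
  (forall w : Cfun E1 t,
     filterdiff (fun w : Cfun E1 t => Fop Phi K w t) (locally w) (dF w)) ->
  (forall x y, a <= x -> x <= y -> y <= c -> h x <= h y) ->
  (forall x e, a <= x <= c -> 0 < e -> exists2 d, 0 < d & forall y,
     a <= y <= c -> Rabs (y - x) < d ->
     h' x * Rabs (y - x) <= Rabs (h y - h x) + e * Rabs (y - x)) ->
  (forall x (w : Cfun E1 T), a <= x <= c -> norm w <= x ->
     opnorm (fun V : Cfun E1 t => minus (dF (Crestrict t w) V) (A (V t)))
       <= h' x) ->
  norm v <= a -> norm (minus u v) <= c - a ->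
  norm (minus (minus (Fop Phi K u t) (A (u t)))
              (minus (Fop Phi K v t) (A (v t)))) <= h c - h a.
Proof.
move=> HA Ht Hac HdF Hh Hh' Hop Hv Huv.
set D := c - a in Huv *.
have HD : 0 <= D by rewrite /D; lra.
(* The segment from [v] to [u], with the residual [g] along it. Since [w x] has norm at most
   [a + x * D], [g] is compared with [h] at that radius. *)
pose w x : Cfun E1 T := plus v (scal x (minus u v)).
pose g x := minus (Fop Phi K (w x) t) (A (w x t)).
have Hw1 : w 1 = u.
  apply: Cfun_eq => s /=; rewrite scal_one plus_comm /minus -plus_assoc.
  by rewrite plus_opp_l plus_zero_r.
have Hw0 : w 0 = v by apply: Cfun_eq => s /=; rewrite scal_zero_l plus_zero_r.
have Hdw x y : minus (Crestrict t (w y)) (Crestrict t (w x))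
               = scal (y - x) (Crestrict t (minus u v)).
  apply: Cfun_eq => s /=.
  set p := v _; set q := plus (u _) _.
  rewrite opp_plus (plus_comm p) plus_assoc -(plus_assoc _ p) plus_assoc.
  rewrite -(plus_assoc _ p) plus_opp_r plus_zero_r -scal_opp_l.
  by rewrite -scal_distr_r.
have Hnw x : 0 <= x -> norm (w x) <= a + x * D.
  move=> Hx; apply: Rle_trans (norm_triangle _ _) _.
  apply: Rplus_le_compat Hv _; apply: Rle_trans (norm_scal _ _) _.
  by rewrite /abs /= Rabs_pos_eq //; apply: Rmult_le_compat_l.
have HaD x : 0 <= x <= 1 -> a <= a + x * D <= c.
  by move=> Hx; rewrite /D in HD *; nra.
rewrite -Hw1 -Hw0 -/(g 1) -/(g 0).
have -> : c = a + 1 * D by rewrite /D; ring.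
have -> : h a = h (a + 0 * D) by congr h; ring.
apply: (mean_value_majorant g (fun x => h (a + x * D))); first exact: Rle_0_1.
  by move=> x y Hx Hxy Hy; apply: Hh; rewrite /D in HD *; nra.
move=> x e Hx He.
(* Two errors of size [e' * D * Rabs (y - x)] arise, one from the Frechet remainder and one from the
   difference quotient of [h]; the [+ 1] covers [D = 0]. *)
set e' := e / (2 * D + 1).
have He' : 0 < e' by apply: Rdiv_lt_0_compat; lra.
have Hee : 2 * (e' * D) <= e.
  have -> : e = e' * (2 * D + 1) by rewrite /e'; field; lra.
  by nra.
have [d1 Hd1 H1] := Hh' (a + x * D) e' (HaD x Hx) He'.
have [Hlin /(_ _ (fun P HP => HP) (mkposreal _ He')) [d2 H2]] :=
  HdF (Crestrict t (w x)).
set W := Crestrict t (minus u v) in Hdw.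
have HW : norm W <= D by apply: Rle_trans (Cnorm_restrict _ _) Huv.
have Hd : 0 < Rmin d1 d2 / (D + 1).
  apply: Rdiv_lt_0_compat; last lra.
  by apply: Rmin_glb_lt => //; exact: cond_pos.
(* With this radius [Rabs (y - x) * D] is below both [d1] and [d2], so the radii and the points of
   the segment are close enough for both estimates. *)
exists (Rmin d1 d2 / (D + 1)) => // y Hy Hyx.
have HyD : Rabs (y - x) * D < Rmin d1 d2.
  have -> : Rmin d1 d2 = Rmin d1 d2 / (D + 1) * (D + 1) by field; lra.
  by have := Rabs_pos (y - x); nra.
have Hn : norm (scal (y - x) W) <= Rabs (y - x) * D.
  apply: Rle_trans (norm_scal _ _) _.
  by apply: Rmult_le_compat_l HW; exact: Rabs_pos.
have {}H1 := H1 (a + y * D) (HaD y Hy).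
have Hay : a + y * D - (a + x * D) = (y - x) * D by ring.
rewrite Hay Rabs_mult (Rabs_pos_eq D) // in H1.
have {}H1 := H1 (Rlt_le_trans _ _ _ HyD (Rmin_l _ _)).
have {}H2 : norm (minus (minus (Fop Phi K (w y) t) (Fop Phi K (w x) t))
    (dF (Crestrict t (w x)) (scal (y - x) W))) <= e' * (Rabs (y - x) * D).
  have := H2 (Crestrict t (w y)); rewrite Hdw !Fop_restrict; try lra.
  move=> H; apply: Rle_trans (H _) _.
    rewrite /ball /= /Cball -/(minus _ _).
    change (norm (minus (Crestrict t (w y)) (Crestrict t (w x))) < d2).
    rewrite Hdw; apply: Rle_lt_trans Hn _.
    exact: Rlt_le_trans HyD (Rmin_r _ _).
  by apply: Rmult_le_compat_l => //; apply: Rlt_le.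
have HlinA := is_linear_minus _ _ Hlin (is_linear_comp _ _ (is_linear_eval t) HA).
have H3 := opnorm_ub _ (scal (y - x) W) HlinA.
have H4 := Hop _ _ (HaD x Hx) (Hnw x (proj1 Hx)).
(* The increment splits into the Frechet remainder of F and the operator F' - A applied to the
   displacement. *)
have Hsplit : minus (g y) (g x) =
    plus (minus (minus (Fop Phi K (w y) t) (Fop Phi K (w x) t))
                (dF (Crestrict t (w x)) (scal (y - x) W)))
         (minus (dF (Crestrict t (w x)) (scal (y - x) W))
                (A (scal (y - x) W t))).
  rewrite -Hdw /g.
  have -> : minus (Crestrict t (w y)) (Crestrict t (w x)) t = minus (w y t) (w x t).
    exact: (congr1 (fun s => minus (w y s) (w x s))
      (clamp_id (conj (proj1 Ht) (Rle_refl t)))).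
  rewrite (linear_minus _ _ _ HA).
  by rewrite -minus_trans minus_minus_swap.
rewrite Hsplit; apply: Rle_trans (norm_triangle _ _) _.
have Hab := Rabs_pos (y - x).
have H5 := opnorm_ge_0 _ HlinA.
have H6 := norm_ge_0 (scal (y - x) W).
apply: Rle_trans (Rplus_le_compat _ _ _ _ H2 H3) _.
apply: (Rle_trans _ (e' * (Rabs (y - x) * D) + h' (a + x * D) * (Rabs (y - x) * D))).
  apply: Rplus_le_compat_l; apply: Rmult_le_compat => //.
apply: (Rle_trans _ (Rabs (h (a + y * D) - h (a + x * D))
  + 2 * (e' * D) * Rabs (y - x))); first lra.
by apply: Rplus_le_compat_l; exact: Rmult_le_compat_r.
Qed.

(** * Convergence of majorized sequences *)

(** Telescoping bounds distances between terms of [w] by differences of [r]; being increasing and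
    bounded, [r] is Cauchy, and so is [w]. *)
Lemma cvg_of_majorant {E : CompleteNormedModule R_AbsRing} {T}
  (w : nat -> Cfun E T) (r : nat -> R) (M : R) :
  (forall k, norm (minus (w k.+1) (w k)) <= r k.+1 - r k) ->
  (forall k, r k <= M) ->
  exists v, filterlim w eventually (locally v).
Proof.
move=> Hw HM.
have Hr k : r k <= r k.+1.
  by have := Rle_trans _ _ _ (norm_ge_0 _) (Hw k); lra.
have Hd k m : norm (minus (w (m + k)%nat) (w k)) <= r (m + k)%nat - r k.
  elim: m => [|m IH]; first by rewrite add0n minus_eq_zero norm_zero; lra.
  apply: Rle_trans (norm_minus_triangle _ (w (m + k)%nat) _) _.
  rewrite addSn.
  by apply: Rle_trans (Rplus_le_compat _ _ _ _ (Hw (m + k)%nat) IH) _; lra.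
have Hle k m : (k <= m)%nat -> norm (minus (w m) (w k)) <= Rabs (r m - r k).
  move=> Hkm; rewrite -(subnK Hkm).
  exact: Rle_trans (Hd _ _) (Rle_abs _).
have /ex_lim_seq_cauchy_corr Hc := ex_finite_lim_seq_incr r M Hr HM.
apply: Cfun_cauchy_cvg => e; have [N HN] := Hc e; exists N => p q Hp Hq.
case: (leqP q p) => [|/ltnW] Hqp; last rewrite norm_minus_sym;
  apply: Rle_lt_trans (Hle _ _ Hqp) _; exact: HN.
Qed.

Lemma norm_limit_le {V : NormedModule R_AbsRing} (w : nat -> V) v M :
  filterlim w eventually (locally v) -> (forall k, norm (w k) <= M) ->
  norm v <= M.
Proof.
move=> /filterlim_locally_ball_norm Hv HM; apply: le_epsilon => e He.
have [N /(_ N (le_n N)) HN] := Hv (mkposreal e He).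
have := norm_triangle (minus v (w N)) (w N).
rewrite /minus -plus_assoc plus_opp_l plus_zero_r -/(minus _ _) norm_minus_sym.
by move: (HM N); rewrite /ball_norm /= in HN; lra.
Qed.

(** * The iteration operator on C([0,T]; E1) *)

Section Iteration.
Context {E1 E2 : CompleteNormedModule R_AbsRing} {n : nat}.
Context (Phi : ('I_n -> E1) -> E1 -> R -> E2).
Context (hPhi : forall p : ('I_n -> E1) * E1 * R,
  continuous (fun p : ('I_n -> E1) * E1 * R => Phi p.1.1 p.1.2 p.2) p).
Context (K : forall i : 'I_n, R -> ('I_i.+1 -> R) -> ('I_i.+1 -> E1) -> E1).
Context (hK : forall (i : 'I_n) (p : R * ('I_i.+1 -> R) * ('I_i.+1 -> E1)),
  continuous (fun p : R * ('I_i.+1 -> R) * ('I_i.+1 -> E1) =>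
    K i p.1.1 p.1.2 p.2) p).
Context (A : E1 -> E2) (Ainv : E2 -> E1).
Context (hA : is_linear A) (hAinv : is_linear Ainv).

Lemma continuous_Lop (u : R -> E1) t :
  (forall s, continuous u s) -> continuous (Lop Phi K A Ainv u) t.
Proof.
move=> Hu.
apply: (continuous_comp (fun t => minus (A (u t)) (Fop Phi K u t)) Ainv);
  last exact: linear_cont.
apply: (continuous_minus (fun t => A (u t))); last exact: continuous_Fop.
by apply: (continuous_comp u A); last exact: linear_cont.
Qed.

(** Evaluating at [clamp T s] makes the result constant outside [0,T], as [Cfun] demands, and agrees
    with [Lop] on [0,T]. *)
Definition CLop {T} (u : Cfun E1 T) : Cfun E1 T.
Proof.
refine (@mkCfun E1 T (fun s => Lop Phi K A Ainv u (clamp T s)) _ _).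
- abstract (move=> s; apply: (continuous_comp (clamp T) (Lop Phi K A Ainv u));
    [exact: continuous_clamp | apply: continuous_Lop => y; exact: cfun_cont]).
- abstract (by move=> s; rewrite clamp_idem).
Defined.

Lemma CLop_norm {T} (u : Cfun E1 T) M : 0 <= T ->
  (forall t, 0 <= t <= T -> norm (minus (Fop Phi K u t) (A (u t))) <= M) ->
  norm (CLop u) <= opnorm Ainv * M.
Proof.
move=> HT HM; apply: Cnorm_lub => s; rewrite /= /Lop.
apply: Rle_trans (opnorm_ub _ _ hAinv) _.
apply: Rmult_le_compat_l; first exact: opnorm_ge_0.
by rewrite norm_minus_sym; apply: HM; exact: clamp_in.
Qed.

(** By linearity L(u) - L(v) is A^-1 applied to (F - A)(v) - (F - A)(u), so increments of the
    residual control those of the iteration. *)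
Lemma CLop_sub {T} (u v : Cfun E1 T) M : 0 <= T ->
  (forall t, 0 <= t <= T ->
     norm (minus (minus (Fop Phi K u t) (A (u t)))
                 (minus (Fop Phi K v t) (A (v t)))) <= M) ->
  norm (minus (CLop u) (CLop v)) <= opnorm Ainv * M.
Proof.
move=> HT HM; apply: Cnorm_lub => s /=.
rewrite -/(minus _ _) /Lop -(linear_minus _ _ _ hAinv).
apply: Rle_trans (opnorm_ub _ _ hAinv) _.
apply: Rmult_le_compat_l; first exact: opnorm_ge_0.
rewrite -norm_opp opp_minus -(opp_minus _ (A (u _))) -(opp_minus _ (A (v _))).
rewrite [minus (opp _) _]/minus opp_opp plus_comm.
apply: HM; exact: clamp_in.
Qed.

End Iteration.

(** * Existence of the solution and convergence of the approximations *)

Theorem theorem2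
  (E1 E2 : CompleteNormedModule R_AbsRing)
  (n : nat) (hn : (1 <= n)%nat)
  (Phi : ('I_n -> E1) -> E1 -> R -> E2)
  (hPhi : forall p : ('I_n -> E1) * E1 * R,
     continuous (fun p : ('I_n -> E1) * E1 * R => Phi p.1.1 p.1.2 p.2) p)
  (K : forall i : 'I_n, R -> ('I_i.+1 -> R) -> ('I_i.+1 -> E1) -> E1)
  (hK : forall (i : 'I_n) (p : R * ('I_i.+1 -> R) * ('I_i.+1 -> E1)),
     continuous (fun p : R * ('I_i.+1 -> R) * ('I_i.+1 -> E1) =>
       K i p.1.1 p.1.2 p.2) p)
  (A : E1 -> E2) (Ainv : E2 -> E1)
  (hA : is_linear A) (hAinv : is_linear Ainv)
  (hAK : forall x, Ainv (A x) = x) (hKA : forall y, A (Ainv y) = y)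
  (Tp rp : R) (hTp : 0 < Tp) (hrp : 0 < rp)
  (* [dF t u] is the Frechet derivative at [u] of F(.,t) on C([0,t];E1) *)
  (dF : forall t : R, Cfun E1 t -> Cfun E1 t -> E2)
  (hdF : forall t, 0 <= t <= Tp -> forall u : Cfun E1 t,
     filterdiff (fun v : Cfun E1 t => Fop Phi K v t) (locally u) (dF t u))
  (rho : Rbar) (hrho : Rbar_lt 0 rho) (hrpI : inI rho rp)
  (* the derivative in r is relative to [0,rho), hence one-sided at r = 0 *)
  (f f'r : R -> R -> R)
  (hf : forall r t, inI rho r -> 0 <= t <= Tp ->
     filterdiff (fun x => f x t) (within (inI rho) (locally r))
       (fun h => scal h (f'r r t)))
  (hPhi0 : Phi (fun _ => zero) zero 0 = zero)
  (condA : forall t r (u : Cfun E1 Tp),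
     0 <= t <= Tp -> inI rho r -> in_ball u r ->
     norm (minus (Fop Phi K u t) (A (u t))) <= f r t)
  (condE : forall t r (u : Cfun E1 Tp),
     0 <= t <= Tp -> inI rho r -> in_ball u r ->
     opnorm (fun V : Cfun E1 t => minus (dF t (Crestrict t u) V) (A (V t)))
       <= f'r r t)
  (condG_pos : forall r t, inI rho r -> 0 <= t <= Tp -> 0 < r -> 0 < t ->
     0 < f r t /\ 0 < f'r r t)
  (condG_mono : forall r1 r2 t1 t2, inI rho r1 -> inI rho r2 ->
     0 <= t1 <= Tp -> 0 <= t2 <= Tp -> r1 <= r2 -> t1 <= t2 ->
     f r1 t1 <= f r2 t2 /\ f'r r1 t1 <= f'r r2 t2)
  (condG_f0 : f 0 0 = 0)
  (condG_f'0 : 0 <= f'r 0 0 < 1)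
  (condG_convex : forall t r1 r2 a, 0 <= t <= Tp -> inI rho r1 -> inI rho r2 ->
     0 <= a <= 1 ->
     f (a * r1 + (1 - a) * r2) t <= a * f r1 t + (1 - a) * f r2 t)
  (hsys1 : rp = opnorm Ainv * f rp Tp)
  (hsys2 : 1 = opnorm Ainv * f'r rp Tp) :
  exists (up : Cfun E1 Tp) (un : nat -> Cfun E1 Tp),
    (forall t, 0 <= t <= Tp -> Fop Phi K up t = zero) /\
    un 0%nat = zero /\
    (forall k t, 0 <= t <= Tp -> un k.+1 t = Lop Phi K A Ainv (un k) t) /\
    filterlim un eventually (locally up) /\
    norm up <= rp.
Proof.

have hb := opnorm_ge_0 _ hAinv.
set b := opnorm Ainv in hb hsys1 hsys2 *.
have hTp0 : 0 <= Tp by lra.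
have hI x : 0 <= x <= rp -> inI rho x.
  move=> Hx; split; first lra.
  by apply: Rbar_le_lt_trans (proj2 hrpI) => /=; lra.
have hTT : 0 <= Tp <= Tp by lra.
have hmono x y s t : 0 <= x -> x <= y -> y <= rp -> 0 <= s -> s <= t -> t <= Tp ->
    f x s <= f y t.
  by move=> *; case: (condG_mono x y s t) => //; try apply: hI; lra.
have hmono' x y s t : 0 <= x -> x <= y -> y <= rp -> 0 <= s -> s <= t -> t <= Tp ->
    f'r x s <= f'r y t.
  by move=> *; case: (condG_mono x y s t) => //; try apply: hI; lra.
pose r k := iter k (fun x => b * f x Tp) 0.
have hr0 : 0 <= b * f 0 Tp.
  apply: Rmult_le_pos => //; rewrite -condG_f0.
  by apply: hmono; lra.
have hrS k : r k.+1 = b * f (r k) Tp by [].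
(* As [rp] is a fixed point of the increasing map [b * f x Tp], that map does not lead above
   [rp]. *)
have hrub x : 0 <= x <= rp -> b * f x Tp <= rp.
  move=> Hx; rewrite [X in _ <= X]hsys1.
  by apply: Rmult_le_compat_l => //; apply: hmono; lra.
have hr k : [/\ 0 <= r k, r k <= r k.+1 & r k.+1 <= rp].
  elim: k => [|k [H1 H2 H3]].
    by rewrite hrS; split=> //; [exact: Rle_refl | apply: hrub; rewrite /r /=; lra].
  split; [lra | rewrite (hrS k.+1) {1}(hrS k) | by apply: (hrub (r k.+1)); lra].
  by apply: Rmult_le_compat_l => //; apply: hmono; lra.
pose step := @CLop _ _ _ Phi hPhi K hK A Ainv hA hAinv Tp.
pose un k := iter k step (zero : Cfun E1 Tp).
(* The derivative relative to [0,rho) gives this lower bound through the reverse triangle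
   inequality; [f'r x Tp] is nonnegative by monotonicity from [f'r 0 0]. *)
have hder x e : 0 <= x <= rp -> 0 < e -> exists2 d, 0 < d & forall y,
    0 <= y <= rp -> Rabs (y - x) < d ->
    f'r x Tp * Rabs (y - x) <= Rabs (f y Tp - f x Tp) + e * Rabs (y - x).
  move=> Hx He.
  have [_ H] := hf x Tp (hI x Hx) hTT.
  have [d Hd] := H x (fun P (HP : locally x P) => filter_le_within _ P HP)
    (mkposreal e He).
  exists d => [|y Hy Hyd]; first exact: cond_pos.
  have := Hd y Hyd (hI y Hy); rewrite /norm /= /abs /= /minus /plus /opp /= /scal /= /mult /=.
  rewrite -!/(Rminus _ _) => H1.
  have Hp : 0 <= f'r x Tp.
    by apply: Rle_trans (proj1 condG_f'0) _; apply: hmono'; lra.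
  have := Rabs_triang_inv ((y - x) * f'r x Tp) (f y Tp - f x Tp).
  rewrite Rabs_mult (Rabs_pos_eq (f'r x Tp)) //.
  rewrite Rabs_minus_sym in H1; lra.
have hstep k : norm (un k) <= r k /\ norm (minus (un k.+1) (un k)) <= r k.+1 - r k.
  elim: k => [|k [H1 H2]].
    split; first by rewrite norm_zero; exact: Rle_refl.
    rewrite /un /r /= minus_zero_r Rminus_0_r.
    (* The first step uses condition (A') at radius 0, where the zero function lies. *)
    apply: CLop_norm => // t Ht; apply: Rle_trans (condA t 0 zero Ht (hI 0 _) _) _.
    - lra.
    - by move=> s _; rewrite norm_zero; exact: Rle_refl.
    - by apply: hmono; lra.
  have [Hk1 Hk2 Hk3] := hr k; have [_ Hk4 Hk5] := hr k.+1.
  split.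
    have := norm_triangle (minus (un k.+1) (un k)) (un k).
    rewrite {1}/minus -plus_assoc plus_opp_l plus_zero_r; lra.
  have -> : r k.+2 - r k.+1 = b * (f (r k.+1) Tp - f (r k) Tp) by rewrite /r /=; ring.
  apply: CLop_sub => // t Ht.
  (* The majorant is taken at time [Tp] for every [t]: monotonicity in time makes the estimate
     uniform on [0,Tp]. *)
  apply: (residual_increment Phi K A Tp t (r k) (r k.+1) (fun x => f x Tp)
    (fun x => f'r x Tp) (dF t)) => //.
  - by apply: hdF.
  - by move=> x y Hx Hxy Hy; apply: hmono; lra.
  - move=> x e Hx He; case: (hder x e) => [||d Hd H]; try lra.
    by exists d => // y Hy; apply: H; lra.
  - move=> x w Hx Hw; apply: Rle_trans (condE t x w Ht (hI x _) _) _; first lra.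
      by move=> s _; apply: Rle_trans Hw; exact: (Cnorm_ub w).
    by apply: hmono'; lra.
have [up hup] := cvg_of_majorant un r rp (fun k => proj2 (hstep k))
  (fun k => let: And3 _ a c := hr k in Rle_trans _ _ _ a c).
have hLop k t : 0 <= t <= Tp -> un k.+1 t = Lop Phi K A Ainv (un k) t.
  by move=> Ht; rewrite /un /= clamp_id.
exists up, un; split; last first.
  do ! split=> //; apply: norm_limit_le hup _ => k.
  by have [? ? ?] := hr k; have [? _] := hstep k; lra.
move=> t Ht.
have hupt : filterlim (fun k => Crestrict t (un k)) eventually
    (locally (Crestrict t up)).
  apply/filterlim_locally => e; move/filterlim_locally: hup => /(_ e).
  apply: filter_imp => k; rewrite /ball /= /Cball => Hk.
  apply: Rle_lt_trans Hk; apply: Cnorm_lub => s /=.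
  exact: (Cnorm_ub (minus (un k) up)).
have hev : filterlim (fun k => un k t) eventually (locally (up t)).
  exact: filterlim_comp hup (linear_cont _ up (is_linear_eval t)).
(* Differentiability of F(.,t) on C([0,t]) gives its continuity there, hence the passage to
   restrictions. Comparing this limit with [hF0] yields the equation. *)
have hF : filterlim (fun k => Fop Phi K (un k) t) eventually
    (locally (Fop Phi K up t)).
  rewrite -(Fop_restrict Phi K up t); last lra.
  apply: (filterlim_ext (fun k => Fop Phi K (Crestrict t (un k)) t)).
    by move=> k; apply: Fop_restrict; lra.
  apply: (filterlim_comp _ _ _ _ (fun v : Cfun E1 t => Fop Phi K v t) _ _ _ hupt).
  exact: (filterdiff_continuous (fun v : Cfun E1 t => Fop Phi K v t)
    (Crestrict t up) (ex_intro _ _ (hdF t Ht (Crestrict t up)))).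
have hFA k : minus (A (un k t)) (A (un k.+1 t)) = Fop Phi K (un k) t.
  rewrite hLop // /Lop hKA /minus opp_plus opp_opp plus_assoc plus_opp_r.
  exact: plus_zero_l.
have hAn : filterlim (fun k => A (un k t)) eventually (locally (A (up t))).
  exact: (filterlim_comp _ _ _ _ A _ _ _ hev (linear_cont _ _ hA)).
have hAnS : filterlim (fun k => A (un k.+1 t)) eventually (locally (A (up t))).
  apply: (filterlim_comp _ _ _ S (fun k => A (un k t)) _ _ _ _ hAn).
  by apply: eventually_subseq => k; exact: Nat.lt_succ_diag_r.
have hF0 : filterlim (fun k => Fop Phi K (un k) t) eventually
    (locally (zero : E2)).
  apply: (filterlim_ext _ _ hFA); rewrite -(minus_eq_zero (A (up t))).
  apply: (filterlim_comp_2 _ _ plus hAn _ (filterlim_plus _ _)).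
  exact: (filterlim_comp _ _ _ _ opp _ _ _ hAnS (filterlim_opp _)).
exact: (filterlim_locally_unique (F := eventually) _ _ _ hF hF0).
Qed.
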